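(* Fix $d\in\mathbb N=\{0,1,2,\dots\}$. Let $\mathcal H$ be a Hilbert space and let $U_0,U_1,\dots,U_d$ be pairwise commuting unitary operators on $\mathcal H$. For every $x\in\mathcal H$, the sequence $(\mathrm{AV}_n(x):n\in\mathbb N)$ of averages $$\mathrm{AV}_n(x)=\frac1{n+1}\sum_{0\le k\le n}U_0\circ U_1^{k}\circ U_2^{\binom k2}\circ\dots\circ U_d^{\binom kd}(x)$$ converges in (the norm of) $\mathcal H$ as $n\to\infty$. In particular, if $p:\mathbb Z\to\mathbb Z$ is a polynomial of degree at most $d$, $U$ is a unitary operator on $\mathcal H$ and $x\in\mathcal H$, then the sequence $\left(\frac1{n+1}\sum_{0\le k\le n}U^{p(k)}(x):n\in\mathbb N\right)$ converges. Furthermore, there exists a universal metastability rate $E_\bullet$, depending only on $d$, that applies to every sequence of averages $$\left(\frac1{n+1}\sum_{0\le k\le n}U_0\circ U_1^{k}\circ U_2^{\binom k2}\circ\dots\circ U_d^{\binom kd}(x):n\in\mathbb N\right),$$ for every $x$ in the unit ball of an arbitrary Hilbert space $\mathcal H$ and arbitrary pairwise commuting unitary operators $U_0,U_1,\dots,U_d$ on $\mathcal H$.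
   Context: $\binom kj=k(k-1)\cdots(k-j+1)/j!$ is the $j$-th binomial coefficient. A polynomial $p:\mathbb Z\to\mathbb Z$ is a function on $\mathbb Z$ with integer values given by a polynomial (with rational coefficients). Metastability rates. Let $\mathcal P^*_{\mathrm{fin}}(X)$ denote the family of finite nonempty subsets of $X$, and $\mathbb N_{\ge i}=\{j\in\mathbb N: j\ge i\}$. A sampling of $\mathbb N$ is an element $\eta\in\prod_{i\in\mathbb N}\mathcal P^*_{\mathrm{fin}}(\mathbb N_{\ge i})$, i.e. a choice of a finite nonempty $\eta_i\subseteq\mathbb N_{\ge i}$ for every $i$. A metastability rate is a family $E_\bullet=(E_{\epsilon,\eta})$, indexed by all real $\epsilon>0$ and all samplings $\eta$, with each $E_{\epsilon,\eta}\in\mathcal P^*_{\mathrm{fin}}(\mathbb N)$. The rate $E_\bullet$ applies to a sequence $(a_n:n\in\mathbb N)$ in a metric space with metric $\mathrm d$ if for every $\epsilon>0$ and every sampling $\eta$ there is $i\in E_{\epsilon,\eta}$ with $\max\{\mathrm d(a_j,a_k): j,k\in\eta_i\}<\epsilon$. *)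

(* Defs.v *)
From HB Require Import structures.
From mathcomp Require Import all_boot all_order all_algebra finmap.
From mathcomp Require Import all_classical all_reals all_analysis.
From mathcomp Require Import complex.

Set Implicit Arguments.
Unset Strict Implicit.
Unset Printing Implicit Defensive.

Import Order.TTheory GRing.Theory Num.Theory.
Import numFieldNormedType.Exports.

Local Open Scope classical_set_scope.
Local Open Scope ring_scope.

(* Hilbert spaces over R and over R[i] are treated uniformly. *)
Variant scalar_kind := RealScalars | ComplexScalars.

Definition scalars (R : realType) (s : scalar_kind) : numFieldType :=
  match s with RealScalars => R | ComplexScalars => R[i] end.

Definition conj_scalar (R : realType) (s : scalar_kind) :
    scalars R s -> scalars R s :=
  match s with RealScalars => idfun | ComplexScalars => @conjc R end.

(* Norms over R[i] are R[i]-valued (real and nonnegative); this brings them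
   back to R. *)
Definition real_part (R : realType) (s : scalar_kind) : scalars R s -> R :=
  match s with RealScalars => idfun | ComplexScalars => @complex.Re R end.

(* [inner] is linear in its first argument. *)
Record hilbertSpace (R : realType) (s : scalar_kind) := HilbertSpace {
  hilbert_carrier :> completeNormedModType (scalars R s);
  inner : {dot hilbert_carrier for @conj_scalar R s};
  normr_inner : forall x : hilbert_carrier, `|x| ^+ 2 = inner x x
}.

Section Averages.
Context {R : realType} {s : scalar_kind} {H : hilbertSpace R s}.

Definition hilbert_dist (x y : H) : R := real_part `|x - y|.

(* U^* U = U U^* = 1 *)
Record unitary := Unitary {
  unitary_fun :> {linear H -> H};
  adjoint : H -> H;
  adjointP : forall x y : H,
    inner H (unitary_fun x) y = inner H x (adjoint y);
  adjointK : cancel unitary_fun adjoint;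
  adjointVK : cancel adjoint unitary_fun
}.

Definition unitary_zpow (U : unitary) (m : int) : H -> H :=
  match m with
  | Posz n => iter n U
  | Negz n => iter n.+1 (adjoint U)
  end.

Definition pairwise_commuting (d : nat) (U : 'I_d.+1 -> unitary) : Prop :=
  forall i j : 'I_d.+1, U i \o U j =1 U j \o U i.

(* The composition starts with U_0 itself, since 'C(k, 0) = 1. *)
Definition binomial_word (d : nat) (U : 'I_d.+1 -> unitary) (k : nat) : H -> H :=
  \big[(fun f g : H -> H => f \o g)/idfun]_(i < d.+1) iter 'C(k, i) (U i).

Definition cesaro (u : nat -> H) (n : nat) : H :=
  (n.+1%:R : scalars R s)^-1 *: \sum_(0 <= k < n.+1) u k.

Definition binomial_average (d : nat) (U : 'I_d.+1 -> unitary) (x : H) :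
    nat -> H :=
  cesaro (fun k => binomial_word U k x).

Definition power_average (p : int -> int) (U : unitary) (x : H) : nat -> H :=
  cesaro (fun k => unitary_zpow U (p k%:Z) x).

End Averages.

Arguments unitary {R s} H.

Definition int_polynomial_le (d : nat) (p : int -> int) : Prop :=
  exists2 q : {poly rat}, (size q <= d.+1)%N &
    forall z : int, (p z)%:~R = q.[z%:~R].

Record finite_nonempty_ge (i : nat) := FiniteNonemptyGe {
  fin_set :> {fset nat};
  fin_set_neq0 : fin_set != fset0;
  fin_set_ge : forall j, j \in fin_set -> (i <= j)%N
}.

Definition sampling := forall i : nat, finite_nonempty_ge i.

Definition metastability_rate (R : realType) :=
  forall eps : R, 0 < eps -> sampling -> finite_nonempty_ge 0.

(* The base value 0 does not affect the maximum: distances are nonnegative and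
   each eta_i is nonempty. *)
Definition rate_applies (R : realType) (T : Type) (dist : T -> T -> R)
    (E : metastability_rate R) (a : nat -> T) : Prop :=
  forall (eps : R) (eps_gt0 : 0 < eps) (eta : sampling),
    exists2 i, i \in fin_set (E eps eps_gt0 eta) &
      \big[Num.max/0]_(j <- fin_set (eta i))
        \big[Num.max/0]_(k <- fin_set (eta i)) dist (a j) (a k) < eps.

(* Main.v *)
(* Convergence only concerns real parts of inner products, so everything takes
   place in a real vector space with a positive semidefinite form, not assumed
   complete.  Replace the exponents 'C(k, i) by a polynomial sequence p of
   degree d in an additive monoid M acting by isometries; let T be the action of
   its leading coefficient.  Induct on d.  In the convex hull of an orbit of a
   power T^m, take y of almost minimal norm, with m such that passing to
   multiples of m hardly increases the infimum.  By the parallelogram law y is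
   almost fixed by every power of T^m, uniformly, while the averages of x - y
   along all T^(m h) are eventually small.  On y, after the substitution
   k -> m k + r, the leading term acts almost trivially and the degree drops.
   On x - y, van der Corput's inequality reduces the averages to correlations
   along p(k + h) - p(k + h'), of degree d - 1, and eventually to linear
   sequences.

   If no finite set of indices worked for a given precision and sampling, one
   could choose a counterexample for each initial segment of nat.  The bounded
   sequences of vectors of these spaces, with the ultralimit of the forms, would
   be a space to which the convergence theorem applies; but finitely many strict
   inequalities that hold for the ultralimit hold in some of the spaces. *)

Require Import Defs.
From HB Require Import structures.
From mathcomp Require Import all_boot all_order all_algebra finmap.
From mathcomp Require Import all_classical all_reals all_analysis.
From mathcomp Require Import complex ring lra.

Set Implicit Arguments.
Unset Strict Implicit.
Unset Printing Implicit Defensive.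

Import Order.TTheory GRing.Theory Num.Theory.
Import numFieldNormedType.Exports.

Local Open Scope classical_set_scope.
Local Open Scope ring_scope.

(** * Semi-inner product spaces and averages *)

(** Semidefiniteness admits bounded sequences under an ultralimit form directly, with no quotient by
    null vectors and no completion. *)
Record preHilbert (R : realType) := PreHilbert {
  carrier :> lmodType R;
  form : carrier -> carrier -> R;
  formC : forall u v, form u v = form v u;
  formP : forall a u v w, form (a *: u + v) w = a * form u w + form v w;
  form_ge0 : forall v, 0 <= form v v
}.

Arguments form {R p} u v : rename.

(** * Seminorm and Cauchy-Schwarz inequality *)

Section SemiNorm.

Context {R : realType} {X : preHilbert R}.
Implicit Types (u v w : X) (a : R).

Lemma formDl u v w : form (u + v) w = form u w + form v w.
Proof. by rewrite -[u]scale1r formP scale1r mul1r. Qed.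

Lemma form0l w : form 0 w = 0.
Proof. by apply: (addrI (form 0 w)); rewrite -formDl !addr0. Qed.

Lemma formZl a u w : form (a *: u) w = a * form u w.
Proof. by rewrite -[a *: u]addr0 formP form0l addr0. Qed.

Lemma formNl u w : form (- u) w = - form u w.
Proof. by rewrite -scaleN1r formZl mulN1r. Qed.

Lemma formBl u v w : form (u - v) w = form u w - form v w.
Proof. by rewrite formDl formNl. Qed.

Lemma formZr a u w : form u (a *: w) = a * form u w.
Proof. by rewrite formC formZl formC. Qed.

Lemma formDr u v w : form u (v + w) = form u v + form u w.
Proof. by rewrite formC formDl !(formC u). Qed.

Lemma formBr u v w : form u (v - w) = form u v - form u w.
Proof. by rewrite formC formBl !(formC u). Qed.

Lemma form_suml (I : Type) (r : seq I) (F : I -> X) w :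
  form (\sum_(i <- r) F i) w = \sum_(i <- r) form (F i) w.
Proof.
by elim/big_rec2: _ => [|i y z _ <-]; [exact: form0l | exact: formDl].
Qed.

Lemma form_sumr (I : Type) (r : seq I) (F : I -> X) w :
  form w (\sum_(i <- r) F i) = \sum_(i <- r) form w (F i).
Proof. by rewrite formC form_suml; apply: eq_bigr => i _; rewrite formC. Qed.

Definition snorm v : R := Num.sqrt (form v v).

Lemma snorm_ge0 v : 0 <= snorm v.
Proof. exact: sqrtr_ge0. Qed.

Lemma sqr_snorm v : snorm v ^+ 2 = form v v.
Proof. by rewrite sqr_sqrtr // form_ge0. Qed.

Lemma snorm_le v a : 0 <= a -> (snorm v <= a) = (form v v <= a ^+ 2).
Proof. by move=> a0; rewrite -sqr_snorm ler_sqr // nnegrE ?snorm_ge0. Qed.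

Lemma snorm0 : snorm 0 = 0.
Proof. by rewrite /snorm form0l sqrtr0. Qed.

Lemma snormZ a v : snorm (a *: v) = `|a| * snorm v.
Proof.
rewrite /snorm formZl formZr mulrA -expr2 sqrtrM ?sqr_ge0 //.
by rewrite sqrtr_sqr.
Qed.

Lemma snormN v : snorm (- v) = snorm v.
Proof. by rewrite -scaleN1r snormZ normrN1 mul1r. Qed.

Lemma snormBC u v : snorm (u - v) = snorm (v - u).
Proof. by rewrite -snormN opprB. Qed.

(** The nonnegative quadratic [pol] is evaluated at [(snorm v, snorm u)] and divided by
    [snorm u * snorm v]. Nonzero vectors may have seminorm 0, so the degenerate cases are treated
    apart. *)
Lemma form_le u v : form u v <= snorm u * snorm v.
Proof.
have pol a b : 0 <= a ^+ 2 * form u u - 2 * (a * b * form u v) +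
    b ^+ 2 * form v v.
  have := form_ge0 (a *: u - b *: v).
  rewrite !(formBl, formBr, formZl, formZr) (formC v u).
  by congr (0 <= _); ring.
have degenerate (x y : X) : snorm x = 0 ->
    (forall a b, 0 <= a ^+ 2 * form x x - 2 * (a * b * form x y) +
       b ^+ 2 * form y y) -> form x y <= 0.
  move=> x0 H; have fx : form x x = 0 by rewrite -sqr_snorm x0 expr0n.
  rewrite leNgt; apply/negP => fxy.
  (* With this [t] the quadratic expression at [(t, 1)] equals -1. *)
  pose t := (form y y + 1) / (2 * form x y).
  have tE : t * form x y = (form y y + 1) / 2 by rewrite /t; field; lra.
  by have := H t 1; rewrite fx mulr1 tE; have := form_ge0 y; lra.
have [u0|u0] := eqVneq (snorm u) 0.
  by rewrite u0 mul0r; apply: degenerate u0 _ => a b; exact: pol.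
have [v0|v0] := eqVneq (snorm v) 0.
  rewrite v0 mulr0 formC; apply: degenerate v0 _ => a b.
  by have := pol b a; rewrite (formC v u); congr (0 <= _); ring.
have u1 : 0 < snorm u by rewrite lt_def u0 snorm_ge0.
have v1 : 0 < snorm v by rewrite lt_def v0 snorm_ge0.
have := pol (snorm v) (snorm u); rewrite -!sqr_snorm => H.
have uv : 0 < snorm u * snorm v by rewrite mulr_gt0.
rewrite -(ler_pM2l uv); lra.
Qed.

Lemma snormD u v : snorm (u + v) <= snorm u + snorm v.
Proof.
rewrite snorm_le ?addr_ge0 ?snorm_ge0 // formDl !formDr (formC v u).
by rewrite -!sqr_snorm; have := form_le u v; lra.
Qed.

Lemma snormB u v : snorm (u - v) <= snorm u + snorm v.
Proof. by rewrite -(snormN v) snormD. Qed.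

Lemma snorm_triangle w u v : snorm (u - v) <= snorm (u - w) + snorm (w - v).
Proof. by have := snormD (u - w) (w - v); rewrite addrA subrK. Qed.

Lemma snorm_le_sub u v : snorm u <= snorm (u - v) + snorm v.
Proof. by have := snormD (u - v) v; rewrite subrK. Qed.

Lemma snorm_sum_le (I : eqType) (r : seq I) (F : I -> X) c :
  (forall i, i \in r -> snorm (F i) <= c) ->
  snorm (\sum_(i <- r) F i) <= (size r)%:R * c.
Proof.
elim: r => [|i r IHr] Fc; first by rewrite big_nil snorm0 mul0r.
rewrite big_cons (le_trans (snormD _ _)) //= -natr1 mulrDl mul1r addrC.
by rewrite lerD ?IHr ?Fc ?mem_head // => j jr; rewrite Fc // inE jr orbT.
Qed.

(** The midpoint is written as the convex combination that [hull_convex] produces. *)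
Lemma parallelogram u v :
  form (u - v) (u - v) = 2 * form u u + 2 * form v v
    - 4 * form (2^-1 *: u + (1 - 2^-1) *: v) (2^-1 *: u + (1 - 2^-1) *: v).
Proof.
rewrite !(formBl, formBr, formDl, formDr, formZl, formZr) (formC v u).
by field.
Qed.

End SemiNorm.

(* Junk value: [avg u 0 = 0]; the average AV_n of the paper is [avg u n.+1]. *)
Definition avg {R : realType} {X : lmodType R} (u : nat -> X) (n : nat) : X :=
  n%:R^-1 *: \sum_(0 <= k < n) u k.

(** * Averages: comparison, shifts and residue classes *)

Section Averages.

Context {R : realType} {X : preHilbert R}.
Implicit Types (u v : nat -> X) (n m : nat) (c : R).

Lemma eq_avg u v : u =1 v -> avg u = avg v.
Proof. by move=> uv; congr avg; exact: funext. Qed.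

Lemma avg_sum u n : n%:R *: avg u n = \sum_(0 <= k < n) u k.
Proof.
case: n => [|n]; first by rewrite scale0r big_geq.
by rewrite scalerA mulfV ?scale1r // pnatr_eq0.
Qed.

Lemma avgD u v n : avg (fun k => u k + v k) n = avg u n + avg v n.
Proof. by rewrite /avg big_split scalerDr. Qed.

Lemma avgZ c u n : avg (fun k => c *: u k) n = c *: avg u n.
Proof. by rewrite /avg -scaler_sumr !scalerA mulrC. Qed.

Lemma avgB u v n : avg (fun k => u k - v k) n = avg u n - avg v n.
Proof.
rewrite avgD; congr (_ + _); rewrite -scaleN1r -avgZ.
by rewrite (@eq_avg _ (fun k => -1 *: v k)) // => k; rewrite scaleN1r.
Qed.

Lemma avg_cst (x : X) n : (0 < n)%N -> avg (fun=> x) n = x.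
Proof.
move=> n0; rewrite /avg big_const_nat subn0 iter_addr_0 -(scaler_nat n x).
by rewrite scalerA mulVf ?scale1r // pnatr_eq0 -lt0n.
Qed.

Lemma avgS u n :
  avg u n.+1 = (1 - n.+1%:R^-1) *: avg u n + n.+1%:R^-1 *: u n.
Proof.
rewrite {1}/avg big_nat_recr //= scalerDr -avg_sum scalerA; congr (_ *: _ + _).
by rewrite -natr1; field; rewrite natr1 pnatr_eq0.
Qed.

Lemma avg_le u c n : (forall k, snorm (u k) <= c) -> snorm (avg u n) <= c.
Proof.
move=> uc; have c0 : 0 <= c := le_trans (snorm_ge0 _) (uc 0%N).
case: n => [|n]; first by rewrite /avg invr0 scale0r snorm0.
rewrite snormZ ger0_norm ?invr_ge0 // mulrC ler_pdivrMr ?ltr0n // mulrC.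
apply: le_trans (snorm_sum_le (c := c) _) _; first by move=> k _; exact: uc.
by rewrite size_iota subn0.
Qed.

(** Multiplied by [n], the difference is the sum of the last [n - N] terms minus [n - N] copies of
    [avg u N]. *)
Lemma snorm_avg_close u c N n : (N <= n)%N -> (forall k, snorm (u k) <= c) ->
  snorm (avg u n - avg u N) <= (2 * (n - N)%:R * c) / n%:R.
Proof.
move=> Nn uc; case: n => [|n] in Nn *.
  by move: Nn; rewrite leqn0 => /eqP->; rewrite subrr snorm0 invr0 mulr0.
rewrite ler_pdivlMr ?ltr0n // mulrC -[X in X * _]ger0_norm // -snormZ.
have -> : n.+1%:R *: (avg u n.+1 - avg u N) =
    \sum_(N <= k < n.+1) u k - (n.+1 - N)%:R *: avg u N.
  rewrite scalerBr avg_sum (@big_cat_nat _ _ _ N) //= -avg_sum.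
  have -> : n.+1%:R = N%:R + (n.+1 - N)%:R :> R by rewrite -natrD subnKC.
  by rewrite scalerDl opprD addrACA subrr add0r.
apply: le_trans (snormB _ _) _; rewrite snormZ ger0_norm //.
have := snorm_sum_le (r := index_iota N n.+1) (fun k _ => uc k).
rewrite size_iota => H; have := avg_le N uc.
move: (n.+1 - N)%:R (ler0n R (n.+1 - N)) H => t t0; nra.
Qed.

(** Multiplied by [n], the difference telescopes to the [h] terms from index [n] on minus the first
    [h] terms. *)
Lemma snorm_avg_shift u c h n : (forall k, snorm (u k) <= c) ->
  snorm (avg (fun k => u (k + h)%N) n - avg u n) <= (2 * h%:R * c) / n%:R.
Proof.
move=> uc; case: n => [|n].
  by rewrite /avg invr0 !scale0r subrr snorm0 mulr0.
rewrite ler_pdivlMr ?ltr0n // mulrC -[X in X * _]ger0_norm // -snormZ.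
have -> : n.+1%:R *: (avg (fun k => u (k + h)%N) n.+1 - avg u n.+1) =
    \sum_(n.+1 <= k < n.+1 + h) u k - \sum_(0 <= k < h) u k.
  rewrite scalerBr !avg_sum; apply/eqP; rewrite subr_eq addrAC.
  rewrite eq_sym subr_eq eq_sym -[X in X == _]addr0; apply/eqP.
  rewrite addr0 [RHS]addrC -[RHS](@big_cat_nat _ _ _ n.+1) ?leq_addr //=.
  rewrite addrC; have -> : \sum_(0 <= i < n.+1) u (i + h)%N =
      \sum_(h <= i < n.+1 + h) u i.
    by rewrite -{2}[h]add0n big_addn addnK.
  by rewrite -(@big_cat_nat _ _ _ h) ?leq_addl.
apply: le_trans (snormB _ _) _.
have := snorm_sum_le (r := index_iota n.+1 (n.+1 + h)) (fun k _ => uc k).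
have := snorm_sum_le (r := index_iota 0 h) (fun k _ => uc k).
rewrite !size_iota subn0 addKn; lra.
Qed.

Lemma near_infty_div (a e : R) : 0 < e -> \forall n \near \oo, a / n%:R <= e.
Proof.
move=> e0; have [a0|a0] := ltP a 0.
  apply: nearW => n; apply: le_trans (ltW e0).
  by rewrite mulr_le0_ge0 ?invr_ge0 ?ler0n // ltW.
have b0 : 0 <= a / e by rewrite divr_ge0 // ltW.
near=> n; have n0 : (0 < n)%N by near: n; exact: nbhs_infty_gt.
rewrite ler_pdivrMr ?ltr0n // mulrC -ler_pdivrMr //.
apply: ltW; apply: lt_le_trans (archi_boundP b0) _; rewrite ler_nat.
by near: n; exact: nbhs_infty_ge.
Unshelve. all: by end_near. Qed.

(** Sorting indices by residue modulo [m] turns the double average into [avg u (n %/ m * m)], which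
    drops fewer than [m] terms. *)
Lemma avg_dilate u c m (e : R) : (0 < m)%N -> (forall k, snorm (u k) <= c) ->
  0 < e -> \forall n \near \oo,
  snorm (avg u n - avg (fun r => avg (fun q => u (m * q + r)%N) (n %/ m)) m)
    <= e.
Proof.
move=> m0 uc e0; have c0 : 0 <= c := le_trans (snorm_ge0 _) (uc 0%N).
have := near_infty_div (2 * m%:R * c) e0; apply: filterS => n le_e.
have -> : avg (fun r => avg (fun q => u (m * q + r)%N) (n %/ m)) m =
    avg u (n %/ m * m).
  rewrite /avg -scaler_sumr scalerA natrM invfM mulrC; congr (_ *: _).
  rewrite exchange_big /=; elim: (n %/ m)%N => [|q IHq].
    by rewrite !big_geq.
  rewrite big_nat_recr //= IHq mulSn addnC.
  rewrite [RHS](@big_cat_nat _ _ _ (q * m)) ?leq_addr //=; congr (_ + _).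
  rewrite -[X in _ = \sum_(X <= _ < _) _]add0n big_addn addKn.
  by apply: eq_bigr => r _; rewrite mulnC addnC.
apply: le_trans le_e; apply: le_trans (snorm_avg_close _ uc) _.
  exact: leq_trunc_div.
rewrite ler_wpM2r ?invr_ge0 ?ler0n // ler_wpM2r // ler_wpM2l // ler_nat.
by rewrite {1}(divn_eq n m) addKn ltnW // ltn_mod.
Qed.

(** The Cauchy property at a single precision: errors add up explicitly and no limit has to
    exist. *)
Definition osc_le u c :=
  exists N, forall n n', (N <= n)%N -> (N <= n')%N ->
    snorm (avg u n - avg u n') <= c.

Lemma osc_le_near u v c e :
  (\forall n \near \oo, snorm (avg u n - avg v n) <= e) ->
  osc_le v c -> osc_le u (c + 2 * e).
Proof.
move=> [N1 _ uv] [N2 vc]; exists (maxn N1 N2) => n n'.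
rewrite !geq_max => /andP[n1 n2] /andP[n1' n2'].
have := uv _ n1; have := uv _ n1'; have := vc _ _ n2 n2' => /=.
have := snorm_triangle (avg v n) (avg u n) (avg u n').
have := snorm_triangle (avg v n') (avg v n) (avg u n').
by rewrite (snormBC (avg v n')); lra.
Qed.

Lemma osc_le_dilate u c m (e : R) : (0 < m)%N -> 0 < e ->
  (exists b, forall k, snorm (u k) <= b) ->
  (forall r, osc_le (fun q => u (m * q + r)%N) c) -> osc_le u (c + e).
Proof.
move=> m0 e0 [b ub] /choice[N oscN].
have e20 : 0 < e / 2 by rewrite divr_gt0.
have [N1 _ HN1] := avg_dilate m0 ub e20.
(* The factor [m] makes [n %/ m] reach the thresholds of all residues [r < m]. *)
exists (maxn N1 (m * \max_(r < m) N r)) => n n'.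
rewrite !geq_max => /andP[n1 n2] /andP[n1' n2'].
have := HN1 _ n1; have := HN1 _ n1' => /=.
pose w n := avg (fun r => avg (fun q => u (m * q + r)%N) (n %/ m)) m.
rewrite -/(w n) -/(w n').
suff : snorm (w n - w n') <= c.
  have := snorm_triangle (w n) (avg u n) (avg u n').
  have := snorm_triangle (w n') (w n) (avg u n').
  by rewrite (snormBC (w n')); lra.
rewrite /w -avgB /avg.
rewrite snormZ ger0_norm ?invr_ge0 // mulrC ler_pdivrMr ?ltr0n // mulrC.
apply: le_trans (snorm_sum_le (c := c) _) _; last by rewrite size_iota subn0.
move=> r; rewrite mem_index_iota => /= rm.
have Nr : (N r <= \max_(r < m) N r)%N by exact: (leq_bigmax (Ordinal rm)).
by apply: oscN; rewrite (leq_trans Nr) // leq_divRL // mulnC.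
Qed.

End Averages.

(** * Polynomial sequences and isometric actions *)

Section VanDerCorput.

Context {R : realType} {X : preHilbert R}.
Implicit Types (u v : nat -> X) (n m : nat) (c : R).

(** The squared deviations of the [u k] from their average have a nonnegative sum. *)
Lemma form_avg_le u n : form (avg u n) (avg u n) <=
  n%:R^-1 * \sum_(0 <= k < n) form (u k) (u k).
Proof.
case: n => [|n]; first by rewrite /avg invr0 scale0r form0l mul0r.
have n0 : 0 < n.+1%:R :> R by rewrite ltr0n.
rewrite mulrC ler_pdivlMr // -subr_ge0; set a := avg u _.
have : 0 <= \sum_(0 <= k < n.+1) form (u k - a) (u k - a).
  by apply: sumr_ge0 => k _; exact: form_ge0.
under eq_bigr do rewrite formBl !formBr (formC a).
rewrite !sumrB -form_suml -avg_sum -/a big_const_nat subn0 iter_addr_0.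
by rewrite formZl -[_ *+ _]mulr_natl; lra.
Qed.

(** Replacing [u] by averages over windows of fixed length [H] hardly changes [avg u n]. The mean
    square of the window averages is a mean of [H ^ 2] correlations, of which only the [H] diagonal
    ones may be large. *)
Lemma van_der_corput u c e : 0 < e -> (forall k, snorm (u k) <= c) ->
  (forall h h', (h' < h)%N -> \forall n \near \oo,
     n%:R^-1 * \sum_(0 <= k < n) form (u (k + h)%N) (u (k + h')%N) <= e ^+ 2) ->
  \forall n \near \oo, snorm (avg u n) <= 2 * e.
Proof.
move=> e0 uc corr; have c0 : 0 <= c := le_trans (snorm_ge0 _) (uc 0%N).
have e2 : 0 < e ^+ 2 by rewrite exprn_gt0.
have eh : 0 < e / 2 by rewrite divr_gt0.
have [H0 _ HH] := near_infty_div (c ^+ 2) e2.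
(* A nonempty window, long enough for the diagonal to contribute at most [e ^+ 2]. *)
pose H := H0.+1; have {HH} HC : c ^+ 2 / H%:R <= e ^+ 2 by apply: HH => /=.
have HR : 0 < H%:R :> R by rewrite ltr0n.
pose w k := avg (fun h => u (k + h)%N) H.
have corrH : \forall n \near \oo, forall p : 'I_H * 'I_H, (p.2 < p.1)%N ->
    n%:R^-1 * \sum_(0 <= k < n) form (u (k + p.1)%N) (u (k + p.2)%N) <= e ^+ 2.
  by apply: filter_forall => -[h h'] /=; have [lt|ge] := ltnP h' h;
    [apply: filterS (corr _ _ lt) | apply: nearW].
near=> n; have n0 : (0 < n)%N by near: n; exact: nbhs_infty_gt.
have nR : 0 < n%:R :> R by rewrite ltr0n.
have wu : snorm (avg w n - avg u n) <= e / 2.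
  have -> : avg w n = avg (fun h => avg (fun k => u (k + h)%N) n) H.
    rewrite /avg -!scaler_sumr !scalerA mulrC; congr (_ *: _).
    exact: exchange_big.
  have -> : avg u n = avg (fun=> avg u n) H by rewrite avg_cst.
  rewrite -avgB /avg snormZ ger0_norm ?invr_ge0 ?ler0n //.
  rewrite [leLHS]mulrC ler_pdivrMr // mulrC.
  apply: le_trans (snorm_sum_le (c := e / 2) _) _; last first.
    by rewrite size_iota subn0.
  move=> h; rewrite mem_index_iota => /= hH.
  apply: le_trans (snorm_avg_shift _ _ uc) _.
  apply: (@le_trans _ _ ((2 * H%:R * c) / n%:R)).
    by rewrite !ler_wpM2r ?invr_ge0 ?ler0n // ler_wpM2l // ler_nat ltnW.
  by near: n; exact: near_infty_div.
have ww : form (avg w n) (avg w n) <= 2 * e ^+ 2.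
  apply: le_trans (form_avg_le _ _) _.
  pose corr_n h h' :=
    n%:R^-1 * \sum_(0 <= k < n) form (u (k + h)%N) (u (k + h')%N).
  have -> : n%:R^-1 * \sum_(0 <= k < n) form (w k) (w k) =
      (H%:R ^+ 2)^-1 * \sum_(h < H) \sum_(h' < H) corr_n h h'.
    under eq_bigr => k _.
      rewrite /w formZl formZr mulrA -expr2 form_suml big_mkord.
      under eq_bigr do rewrite form_sumr big_mkord.
      over.
    rewrite -mulr_sumr mulrCA exprVn; congr (_ * _).
    rewrite exchange_big mulr_sumr; apply: eq_bigr => h _ /=.
    by rewrite exchange_big mulr_sumr.
  have diag h : corr_n h h <= c ^+ 2.
    rewrite /corr_n [leLHS]mulrC ler_pdivrMr // mulrC.
    apply: (@le_trans _ _ (\sum_(0 <= k < n) c ^+ 2)).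
      by apply: ler_sum => k _; rewrite -snorm_le.
    by rewrite big_const_nat subn0 iter_addr_0 -[_ *+ _]mulr_natl.
  have off (h h' : 'I_H) : h != h' -> corr_n h h' <= e ^+ 2.
    rewrite neq_ltn => /orP[lt|lt]; last first.
      by have := near corrH n => /(_ _ (h, h')); apply.
    rewrite /corr_n; under eq_bigr do rewrite formC.
    by have := near corrH n => /(_ _ (h', h)); apply.
  have row (h : 'I_H) : \sum_(h' < H) corr_n h h' <= c ^+ 2 + H%:R * e ^+ 2.
    rewrite (bigD1 h) //= lerD ?diag //.
    apply: (@le_trans _ _ (\sum_(h' < H) e ^+ 2)); last first.
      by rewrite sumr_const card_ord mulr_natl.
    rewrite [leRHS](bigD1 h) //= -[leLHS]add0r lerD ?sqr_ge0 //.
    by apply: ler_sum => h' h'h; apply: off; rewrite eq_sym.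
  rewrite [leLHS]mulrC ler_pdivrMr ?exprn_gt0 //.
  apply: (@le_trans _ _ (\sum_(h < H) (c ^+ 2 + H%:R * e ^+ 2))).
    by apply: ler_sum => h _; exact: row.
  rewrite sumr_const card_ord -[_ *+ _]mulr_natl.
  by move: HC; rewrite ler_pdivrMr //; nra.
(* Since [2 <= (3 / 2) ^ 2]; the remaining [e / 2] is spent in [wu]. *)
have : snorm (avg w n) <= 3 / 2 * e by rewrite snorm_le; nra.
by have := snorm_le_sub (avg u n) (avg w n); rewrite snormBC; lra.
Unshelve. all: by end_near. Qed.

End VanDerCorput.

(* p is a polynomial sequence of degree at most d, L being its coefficient at
   the binomial 'C(k, d). *)
Fixpoint leadp {M : nmodType} (d : nat) (p : nat -> M) (L : M) : Prop :=
  if d is d'.+1 then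
    exists2 q : nat -> M, leadp d' q L & forall k, p k.+1 = p k + q k
  else forall k, p k = L.

(** * Finite differences of polynomial sequences *)

Section PolynomialSequences.

Context {M : nmodType}.
Implicit Types (p q : nat -> M) (L : M).

Lemma leadp_ext d p q L : p =1 q -> leadp d p L -> leadp d q L.
Proof.
case: d => [|d] pq /=; first by move=> H k; rewrite -pq.
by case=> r rL pr; exists r => // k; rewrite -!pq.
Qed.

Lemma leadp_const d (a : M) : leadp d.+1 (fun=> a) 0.
Proof.
by elim: d a => [|d IHd] a; exists (fun=> 0) => [|k];
  rewrite ?addr0 //; exact: IHd.
Qed.

Lemma leadpD d p q L L' : leadp d p L -> leadp d q L' ->
  leadp d (fun k => p k + q k) (L + L').
Proof.
elim: d p q => [|d IHd] p q /=; first by move=> pL qL k; rewrite pL qL.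
move=> [p' p'L pE] [q' q'L qE]; exists (fun k => p' k + q' k); first exact: IHd.
by move=> k; rewrite pE qE addrACA.
Qed.

Lemma leadp_sum d (F : nat -> nat -> M) L n :
  (forall i, leadp d (F i) L) ->
  leadp d (fun k => \sum_(0 <= i < n) F i k) (L *+ n).
Proof.
move=> FL; elim: n => [|n IHn].
  apply: (@leadp_ext _ (fun=> 0)) => [k|]; first by rewrite big_geq.
  by case: d {FL} => // d; exact: leadp_const.
apply: (@leadp_ext _ (fun k => \sum_(0 <= i < n) F i k + F n k)) => [k|].
  by rewrite big_nat_recr.
by rewrite mulrSr; exact: leadpD.
Qed.

Lemma sum_delta p q : (forall k, p k.+1 = p k + q k) -> forall k m,
  p (k + m)%N = p k + \sum_(0 <= i < m) q (k + i)%N.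
Proof.
move=> pE k; elim=> [|m IHm]; first by rewrite addn0 big_geq ?addr0.
by rewrite addnS pE IHm big_nat_recr //= addrA.
Qed.

Lemma leadp_shift d p L h : leadp d p L -> leadp d (fun k => p (k + h)%N) L.
Proof.
elim: d p => [|d IHd] p /=; first by move=> pL k.
case=> q qL pE.
by exists (fun k => q (k + h)%N) => [|k]; [exact: IHd | exact: pE].
Qed.

(** One step of the dilated sequence is a sum of [m] dilated differences, each with leading
    coefficient multiplied by a power of [m] one lower. *)
Lemma leadp_dilate d p L m r : leadp d p L ->
  leadp d (fun k => p (m * k + r)%N) (L *+ (m ^ d)).
Proof.
elim: d p r => [|d IHd] p r /=; first by move=> pL k; rewrite expn0.
case=> q qL pE.
exists (fun k => \sum_(0 <= i < m) q (m * k + (r + i))%N); last first.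
  move=> k; rewrite mulnS -addnA addnC (sum_delta pE).
  by congr (_ + _); apply: eq_bigr => i _; rewrite addnA.
rewrite expnSr mulrnA.
by apply: (leadp_sum (F := fun i k => q (m * k + (r + i))%N)) => i; exact: IHd.
Qed.

(** The difference is a sum of [h - h'] shifts of the first difference. It is stated additively
    because [M] is only a monoid. *)
Lemma leadp_difference d p L h h' : (h' < h)%N -> leadp d.+1 p L ->
  exists2 q, leadp d q (L *+ (h - h')) &
    forall k, p (k + h)%N = p (k + h')%N + q k.
Proof.
move=> hh [q qL pE].
exists (fun k => \sum_(0 <= i < h - h') q (k + (h' + i))%N).
  apply: (leadp_sum (F := fun i k => q (k + (h' + i))%N)) => i.
  exact: leadp_shift.
move=> k; rewrite -{1}(subnKC (ltnW hh)) addnA (sum_delta pE).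
by congr (_ + _); apply: eq_bigr => i _; rewrite addnA.
Qed.

(** Splits off the top binomial term: the [e] constructed by repeated summation is ['C(k, d.+1)]. *)
Lemma leadp_split d p L : leadp d.+1 p L ->
  exists q L' (e : nat -> nat), leadp d q L' /\ forall k, p k = q k + L *+ e k.
Proof.
elim: d p => [|d IHd] p [q qL pE].
  exists (fun=> p 0%N), (p 0%N), id; split=> // k.
  elim: k => [|k IHk]; first by rewrite mulr0n addr0.
  by rewrite pE IHk qL mulrSr addrA.
have [q' [L' [e [q'L qE]]]] := IHd _ qL.
exists (fun k => p 0%N + \sum_(0 <= i < k) q' i), L'.
exists (fun k => \sum_(0 <= i < k) e i)%N; split.
  by exists q' => // k; rewrite big_nat_recr //= addrA.
elim=> [|k IHk]; first by rewrite !big_geq // mulr0n !addr0.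
rewrite pE IHk qE !big_nat_recr //= mulrnDr addrACA; congr (_ + _).
by rewrite addrA.
Qed.

End PolynomialSequences.

(** Commutativity of the operators is carried by the commutative monoid of exponents:
    [{ffun 'I_d.+1 -> nat}] for the binomial words, [int] for the powers of one unitary. *)
Record isometric_action (R : realType) (M : nmodType) (X : preHilbert R) :=
  IsometricAction {
    act :> M -> X -> X;
    act0 : forall v, act 0 v = v;
    actD : forall a b v, act (a + b) v = act a (act b v);
    actP : forall a (c : R) u v, act a (c *: u + v) = c *: act a u + act a v;
    act_form : forall a u v, form (act a u) (act a v) = form u v
  }.

(** For linear [S], the convex hull of the forward orbit of [x], without closure; binary
    combinations suit induction. *)
Inductive orbit_hull (R : realType) (X : lmodType R) (S : X -> X) (x : X) :
    X -> Prop :=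
| hull_base : orbit_hull S x x
| hull_act v : orbit_hull S x v -> orbit_hull S x (S v)
| hull_convex (t : R) u v : 0 <= t <= 1 -> orbit_hull S x u ->
    orbit_hull S x v -> orbit_hull S x (t *: u + (1 - t) *: v).

(** * Averages along actions and orbit hulls *)

Section Actions.

Context {R : realType} {M : nmodType} {X : preHilbert R}.
Variable T : isometric_action M X.
Implicit Types (u v x y z : X) (a L : M) (p : nat -> M) (m n d : nat).

Lemma act_snorm a v : snorm (T a v) = snorm v.
Proof. by rewrite /snorm act_form. Qed.

Lemma act_add a u v : T a (u + v) = T a u + T a v.
Proof. by rewrite -[u]scale1r actP !scale1r. Qed.

Lemma act_zero a : T a 0 = 0.
Proof. by apply: (addrI (T a 0)); rewrite -act_add !addr0. Qed.

Lemma act_scale a c v : T a (c *: v) = c *: T a v.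
Proof. by rewrite -[c *: v]addr0 actP act_zero addr0. Qed.

Lemma act_sub a u v : T a (u - v) = T a u - T a v.
Proof. by rewrite act_add -scaleN1r act_scale scaleN1r. Qed.

Lemma act_avg a (u : nat -> X) n : T a (avg u n) = avg (fun k => T a (u k)) n.
Proof.
rewrite /avg act_scale; congr (_ *: _).
by elim/big_rec2: _ => [|i y w _ <-]; rewrite ?act_zero ?act_add.
Qed.

Lemma hull_iter a x h v :
  orbit_hull (T a) x v -> orbit_hull (T a) x (T (a *+ h) v).
Proof.
move=> xv; elim: h => [|h IHh]; first by rewrite mulr0n act0.
by rewrite mulrS actD; exact: hull_act.
Qed.

Lemma hull_snorm a x v : orbit_hull (T a) x v -> snorm v <= snorm x.
Proof.
elim=> [|w _ IH|t w1 w2 /andP[t0 t1] _ IH1 _ IH2] //.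
  by rewrite act_snorm.
apply: le_trans (snormD _ _) _; rewrite !snormZ !ger0_norm ?subr_ge0 //.
have t1' : 0 <= 1 - t by rewrite subr_ge0.
nra.
Qed.

Lemma hull_avg a x (u : nat -> X) n : (forall k, orbit_hull (T a) x (u k)) ->
  orbit_hull (T a) x (avg u n.+1).
Proof.
move=> xu; elim: n => [|n IHn].
  by rewrite /avg big_nat1 invr1 scale1r.
rewrite avgS; set t := _^-1; rewrite -[X in _ + X *: _](subKr 1 t).
apply: hull_convex => //; rewrite subr_ge0 gerBl invr_ge0 ler0n andbT.
by rewrite invf_le1 ?ltr0n // ler1n.
Qed.

(** All points of the hull have asymptotically the same averages: applying [T a] shifts the orbit by
    one, and averages respect convex combinations. *)
Lemma hull_avg_close a x v (e : R) : orbit_hull (T a) x v -> 0 < e ->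
  \forall n \near \oo, snorm (avg (fun k => T (a *+ k) v) n -
    avg (fun k => T (a *+ k) x) n) <= e.
Proof.
move=> xv; elim: xv e => {v} [|v xv IH|t u v /andP[t0 t1] xu IHu xv IHv] e e0.
- by apply: nearW => n; rewrite subrr snorm0 ltW.
- have e2 : 0 < e / 2 by rewrite divr_gt0.
  have vb k : snorm (T (a *+ k) v) <= snorm v by rewrite act_snorm.
  have := near_infty_div (2 * 1%:R * snorm v) e2.
  apply: filterS2 (IH _ e2) => n le1 le2.
  have := le_trans (snorm_avg_shift 1 n vb) le2.
  rewrite (@eq_avg _ _ _ (fun k => T (a *+ k) (T a v))); last first.
    by move=> k; rewrite addn1 mulrSr actD.
  move=> le3; have := snorm_triangle (avg (fun k => T (a *+ k) v) n)
    (avg (fun k => T (a *+ k) (T a v)) n) (avg (fun k => T (a *+ k) x) n).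
  by move: le1 le3; lra.
- apply: filterS2 (IHu _ e0) (IHv _ e0) => n.
  set X0 := avg (fun k => T (a *+ k) x) n.
  rewrite (@eq_avg _ _ (fun k => T (a *+ k) (_ + _))
    (fun k => t *: T (a *+ k) u + (1 - t) *: T (a *+ k) v)); last first.
    by move=> k; rewrite actP act_scale.
  rewrite avgD !avgZ -/X0; set U := avg _ n; set V := avg _ n => leU leV.
  have -> : t *: U + (1 - t) *: V - X0 = t *: (U - X0) + (1 - t) *: (V - X0).
    by rewrite !scalerBr addrACA -opprD -scalerDl [t + _]addrC subrK scale1r.
  apply: le_trans (snormD _ _) _; rewrite !snormZ !ger0_norm ?subr_ge0 //.
  have t1' : 0 <= 1 - t by rewrite subr_ge0.
  nra.
Qed.

End Actions.

(** * Convergence of polynomial averages *)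

Section Convergence.

Context {R : realType} {M : nmodType} {X : preHilbert R}.
Variable T : isometric_action M X.
Implicit Types (u v x y z : X) (a L : M) (p : nat -> M) (m n d : nat).

(** In a Hilbert space this is the squared norm of the projection of [x] onto the vectors fixed by
    [T a]. *)
Definition hull_inf x a : R :=
  inf [set form v v | v in orbit_hull (T a) x].

Lemma hull_inf_le x a v : orbit_hull (T a) x v -> hull_inf x a <= form v v.
Proof.
move=> xv; apply: ge_inf; last by exists v.
by exists 0 => _ [w _ <-]; exact: form_ge0.
Qed.

Lemma hull_inf_adherent x a e : 0 < e ->
  exists2 v, orbit_hull (T a) x v & form v v < hull_inf x a + e.
Proof.
move=> e0; have [|_ [v xv <-] lt] := @inf_adherent _
  [set form v v | v in orbit_hull (T a) x] _ e0; last by exists v.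
split; first by exists (form x x), x => //; exact: hull_base.
by exists 0 => _ [w _ <-]; exact: form_ge0.
Qed.

(** Over all positive multiples of [L] the infima are bounded by [form x x]; [m] comes within [e] of
    their supremum, which no multiple of [m] exceeds. *)
Lemma hull_inf_stable x L e : 0 < e -> exists2 m, (0 < m)%N &
  forall h, (0 < h)%N -> hull_inf x (L *+ m *+ h) <= hull_inf x (L *+ m) + e.
Proof.
move=> e0; pose E := [set hull_inf x (L *+ m.+1) | m in [set: nat]].
have supE : has_sup E.
  split; first by exists (hull_inf x (L *+ 1)), 0%N.
  by exists (form x x) => _ [m _ <-]; exact/hull_inf_le/hull_base.
have [_ [m _ <-] lt] := sup_adherent e0 supE.
exists m.+1 => // h h0; rewrite -mulrnA.
have : hull_inf x (L *+ (m.+1 * h)) <= sup E.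
  apply: sup_upper_bound => //.
  by exists (m.+1 * h).-1; rewrite ?prednK ?muln_gt0.
lra.
Qed.

(** The midpoint stays in the hull, so the parallelogram law leaves [2 * 3 * e + 2 * e]. *)
Lemma hull_near_min x a v w e : orbit_hull (T a) x v -> orbit_hull (T a) x w ->
  form v v <= hull_inf x a + e -> form w w <= hull_inf x a + 3 * e ->
  form (w - v) (w - v) <= 8 * e.
Proof.
move=> xv xw vle wle; rewrite parallelogram.
have : orbit_hull (T a) x (2^-1 *: w + (1 - 2^-1) *: v).
  by apply: hull_convex => //; lra.
by move/hull_inf_le; lra.
Qed.

(** The averages of a nearly minimal [v] are no longer than [v], and those of [x] approach them. *)
Lemma avg_near_min x a e : 0 < e ->
  \forall n \near \oo, form (avg (fun k => T (a *+ k) x) n)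
    (avg (fun k => T (a *+ k) x) n) <= hull_inf x a + 2 * e.
Proof.
move=> e0; have [v xv vlt] := hull_inf_adherent x a e0.
have vx := hull_snorm xv; have x0 := snorm_ge0 x; have v0 := snorm_ge0 v.
(* This gives [(snorm v + eta) ^+ 2 <= snorm v ^+ 2 + e]. *)
pose eta := Num.min 1 (e / (2 * snorm x + 1)).
have den0 : 0 < 2 * snorm x + 1 by lra.
have eta0 : 0 < eta by rewrite lt_min ltr01 divr_gt0.
have eta1 : eta <= 1 by rewrite ge_min lexx.
have etae : eta * (2 * snorm x + 1) <= e.
  by rewrite -ler_pdivlMr // ge_min lexx orbT.
have := hull_avg_close xv eta0; apply: filterS => n; set A := avg _ n => cl.
set B := avg _ n in cl *.
have Av : snorm A <= snorm v by apply: avg_le => k; rewrite act_snorm.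
have : snorm B <= snorm v + eta.
  by have := snorm_le_sub B A; rewrite snormBC; lra.
rewrite snorm_le ?addr_ge0 ?(ltW eta0) // => H; apply: le_trans H _.
by rewrite -sqr_snorm in vlt; nra.
Qed.

(** An approximate mean ergodic splitting. Both the translates of the near minimizer [y] and the
    long averages of [x] along [L *+ m *+ h] are near minimizers in the same hull, hence close to
    [y]. *)
Lemma ergodic_decomposition L x (e : R) : 0 < e -> exists m y,
  [/\ (0 < m)%N, snorm y <= snorm x,
    forall j, snorm (T (L *+ m *+ j) y - y) <= e &
    forall h, (0 < h)%N -> \forall n \near \oo,
      snorm (avg (fun k => T (L *+ m *+ h *+ k) (x - y)) n) <= e].
Proof.
move=> e0; pose d := e ^+ 2 / 32.
have d0 : 0 < d by rewrite divr_gt0 // exprn_gt0.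
have [m m0 mh] := hull_inf_stable x L d0.
have [y xy yle] := hull_inf_adherent x (L *+ m) d0.
have close w : orbit_hull (T (L *+ m)) x w ->
    form w w <= hull_inf x (L *+ m) + 3 * d -> snorm (w - y) <= e / 2.
  move=> xw wle; rewrite snorm_le; last by lra.
  by apply: le_trans (hull_near_min xy xw (ltW yle) wle) _; rewrite /d; lra.
have yinv j : snorm (T (L *+ m *+ j) y - y) <= e / 2.
  by apply: close; [exact: hull_iter | rewrite act_form; lra].
exists m, y; split=> // [|j|h h0]; first exact: hull_snorm xy.
  by apply: le_trans (yinv j) _; lra.
near=> n; have n0 : (0 < n)%N by near: n; exact: nbhs_infty_gt.
rewrite (@eq_avg _ _ _ (fun k => T (L *+ m *+ h *+ k) x -
  T (L *+ m *+ h *+ k) y)); last by move=> k; rewrite act_sub.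
rewrite avgB; set A := avg _ n; set B := avg _ n.
have By : snorm (B - y) <= e / 2.
  rewrite -{1}(avg_cst y n0) /B -avgB; apply: avg_le => k.
  by rewrite -mulrnA.
have Ay : snorm (A - y) <= e / 2.
  apply: close.
    rewrite /A; case: (n) n0 => // n' _; apply: hull_avg => k.
    by rewrite -mulrnA; apply/hull_iter/hull_base.
  (* Passing from [L *+ m] to its multiple costs one more [d], which makes [3 * d]. *)
  have := mh _ h0; suff : form A A <= hull_inf x (L *+ m *+ h) + 2 * d by lra.
  by rewrite /A; near: n; exact: avg_near_min.
by have := snorm_triangle y A B; rewrite (snormBC y); lra.
Unshelve. all: by end_near. Qed.

(** [eta] is chosen before [L], [p] and [z], so that it can be passed to [ergodic_decomposition].
    Leading coefficients range over multiples of [L] because differencing multiplies them. *)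
Lemma ergodic_avg d (c e : R) : 0 <= c -> 0 < e -> exists2 eta : R, 0 < eta &
  forall L p h z, (0 < h)%N -> leadp d.+1 p (L *+ h) -> snorm z <= c ->
    (forall h, (0 < h)%N -> \forall n \near \oo,
      snorm (avg (fun k => T (L *+ h *+ k) z) n) <= eta) ->
    \forall n \near \oo, snorm (avg (fun k => T (p k) z) n) <= e.
Proof.
move=> c0; elim: d e => [|d IHd] e e0.
  exists e => // L p h z h0 [q qL pE] zc zerg.
  (* A linear sequence is [p 0] plus the multiples of [L *+ h], and the isometry [T (p 0)] preserves
     seminorms. *)
  apply: filterS (zerg h h0) => n; rewrite -(act_snorm T (p 0%N)) act_avg.
  rewrite (@eq_avg _ _ _ (fun k => T (p k) z)) // => k; rewrite -actD.
  congr (T _ _); elim: k => [|k IHk]; first by rewrite mulr0n addr0.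
  by rewrite pE qL -IHk mulrSr addrA.
have c1 : 0 < c + 1 by lra.
have e2 : 0 < e / 2 by lra.
(* Multiplied by [snorm z <= c] this stays below [(e / 2) ^+ 2]; the denominator [c + 1] is positive
   even for [c = 0]. *)
have e'0 : 0 < (e / 2) ^+ 2 / (c + 1) by rewrite divr_gt0 // exprn_gt0.
have [eta eta0 Heta] := IHd _ e'0; exists eta => // L p h z h0 pL zc zerg.
have -> : e = 2 * (e / 2) by lra.
apply: (@van_der_corput _ _ _ c) => // [k|i i' i'i]; first by rewrite act_snorm.
have [q qL pE] := leadp_difference i'i pL.
rewrite -mulrnA in qL.
have hi0 : (0 < h * (i - i'))%N by rewrite muln_gt0 h0 subn_gt0.
apply: filterS (Heta L q _ z hi0 qL zc zerg) => n le_n.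
(* The common isometry [T (p (k + i'))] cancels, leaving an average of lower degree paired with
   [z]. *)
have -> : n%:R^-1 * (\sum_(0 <= k < n)
      form (T (p (k + i)%N) z) (T (p (k + i')%N) z)) =
    form (avg (fun k => T (q k) z) n) z.
  rewrite formZl form_suml; congr (_ * _); apply: eq_bigr => k _.
  by rewrite pE actD act_form.
apply: le_trans (form_le _ _) _.
have := snorm_ge0 z; have := snorm_ge0 (avg (fun k => T (q k) z) n).
move: le_n; rewrite ler_pdivlMr //; nra.
Qed.

Theorem polynomial_avg_cauchy d p L x (e : R) : leadp d p L -> 0 < e ->
  osc_le (fun k => T (p k) x) e.
Proof.
elim: d p L x e => [|d IHd] p L x e pL e0.
  exists 1%N => n n' n1 n1'.
  rewrite (@eq_avg _ _ _ (fun=> T L x)); last by move=> k; rewrite pL.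
  by rewrite !avg_cst // subrr snorm0 ltW.
have x0 := snorm_ge0 x.
have e8 : 0 < e / 8 by lra.
have e4 : 0 < e / 4 by lra.
have c0 : 0 <= 2 * snorm x by lra.
have [eta eta0 Heta] := ergodic_avg d c0 e8.
have min0 : 0 < Num.min eta (e / 8) by rewrite lt_min eta0.
have [m [y [m0 yx yinv yerg]]] := ergodic_decomposition L x min0.
(* In order: the induction hypothesis, the comparison with the sequence of lower degree, the
   dilation. *)
have -> : e = e / 4 + 2 * (e / 4) + e / 4 by lra.
apply: (osc_le_dilate m0) => // [|r].
  by exists (snorm x) => k; rewrite act_snorm.
(* The leading coefficient becomes [L *+ m *+ m ^ d], a multiple of [L *+ m]: it almost fixes [y],
   and [ergodic_avg] applies to [x - y]. *)
have := leadp_dilate m r pL; rewrite expnS mulrnA => prL.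
have md0 : (0 < m ^ d)%N by rewrite expn_gt0 m0.
have xy : snorm (x - y) <= 2 * snorm x by have := snormB x y; lra.
have [q [L' [f [qL prE]]]] := leadp_split prL.
apply: (@osc_le_near _ _ _ (fun k => T (q k) y)); last exact: IHd qL e4.
have zerg h : (0 < h)%N -> \forall n \near \oo,
    snorm (avg (fun k => T (L *+ m *+ h *+ k) (x - y)) n) <= eta.
  move=> h0; apply: filterS (yerg h h0) => n /le_trans; apply.
  by rewrite ge_min lexx.
apply: filterS (Heta (L *+ m) _ _ _ md0 prL xy zerg) => n le_n.
rewrite (@eq_avg _ _ (fun k => T (p (m * k + r)%N) x)
  (fun k => T (p (m * k + r)%N) (x - y) + T (p (m * k + r)%N) y)); last first.
  by move=> k; rewrite -act_add subrK.
rewrite avgD -addrA -avgB; apply: le_trans (snormD _ _) _.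
suff : snorm (avg (fun k => T (p (m * k + r)%N) y - T (q k) y) n) <= e / 8.
  by move: le_n; lra.
apply: avg_le => k; rewrite prE actD -act_sub act_snorm -mulrnA.
by apply: le_trans (yinv _) _; rewrite ge_min lexx orbT.
Qed.

End Convergence.

(** * Ultraproducts and uniformity *)

Section UltraLimits.

Context {R : realType} (F : set_system nat) {FU : UltraFilter F}.

Definition ulim (u : nat -> R) : R := lim (u @ F).

(** Compactness of the segment gives a cluster point, and an ultrafilter converges to its cluster
    points. *)
Lemma ulimP (u : nat -> R) c : (forall n, `|u n| <= c) -> u @ F --> ulim u.
Proof.
move=> uc; suff [l ul] : exists l : R, u @ F --> l.
  by apply/cvg_ex; exists l.
have [|l [_ clu]] := @segment_compact R (- c) c (u @ F) _.
  by apply: nearW => n; rewrite /= in_itv /= -ler_norml.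
exists l => A lA; have [//|FA] := in_ultra_setVsetC (u @^-1` A) FU.
by have [x [nAx]] := clu (~` A) A FA lA.
Qed.

Lemma ulim_unique (u : nat -> R) l : u @ F --> l -> ulim u = l.
Proof. by move/cvg_lim; apply; exact: norm_hausdorff. Qed.

End UltraLimits.

(** * Ultraproducts of spaces and of actions *)

Section Ultraproduct.

Context {R : realType} (F : set_system nat) {FU : UltraFilter F}.
Variable X : nat -> preHilbert R.

Record bounded_seq := BoundedSeq {
  bseq_val :> forall n, X n;
  bseq_bounded : exists c, forall n, snorm (bseq_val n) <= c
}.

Lemma bounded_seq_eq (x y : bounded_seq) : (forall n, x n = y n) -> x = y.
Proof.
case: x y => [x xb] [y yb] /= xy.
have {xy} xy : x = y by exact: functional_extensionality_dep.
by case: y / xy yb => yb; congr BoundedSeq; exact: Prop_irrelevance.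
Qed.

HB.instance Definition _ := gen_eqMixin bounded_seq.

HB.instance Definition _ := gen_choiceMixin bounded_seq.

Fact bseq0_bounded : exists c, forall n, snorm (0 : X n) <= c.
Proof. by exists 0 => n; rewrite snorm0. Qed.

Fact bseqN_bounded (x : bounded_seq) : exists c, forall n, snorm (- x n) <= c.
Proof. by have [c xc] := bseq_bounded x; exists c => n; rewrite snormN. Qed.

Fact bseqD_bounded (x y : bounded_seq) :
  exists c, forall n, snorm (x n + y n) <= c.
Proof.
have [c xc] := bseq_bounded x; have [b yb] := bseq_bounded y.
by exists (c + b) => n; rewrite (le_trans (snormD _ _)) ?lerD.
Qed.

Fact bseqZ_bounded (a : R) (x : bounded_seq) :
  exists c, forall n, snorm (a *: x n) <= c.
Proof.
have [c xc] := bseq_bounded x.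
by exists (`|a| * c) => n; rewrite snormZ ler_wpM2l.
Qed.

Definition bseq0 := BoundedSeq bseq0_bounded.

Definition bseqN x := BoundedSeq (bseqN_bounded x).

Definition bseqD x y := BoundedSeq (bseqD_bounded x y).

Definition bseqZ a x := BoundedSeq (bseqZ_bounded a x).

Fact bseqDA : associative bseqD.
Proof. by move=> x y z; apply: bounded_seq_eq => n /=; rewrite addrA. Qed.

Fact bseqDC : commutative bseqD.
Proof. by move=> x y; apply: bounded_seq_eq => n /=; rewrite addrC. Qed.

Fact bseqD0 : left_id bseq0 bseqD.
Proof. by move=> x; apply: bounded_seq_eq => n /=; rewrite add0r. Qed.

Fact bseqDN : left_inverse bseq0 bseqN bseqD.
Proof. by move=> x; apply: bounded_seq_eq => n /=; rewrite addNr. Qed.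

HB.instance Definition _ :=
  GRing.isZmodule.Build bounded_seq bseqDA bseqDC bseqD0 bseqDN.

Fact bseqZA a b x : bseqZ a (bseqZ b x) = bseqZ (a * b) x.
Proof. by apply: bounded_seq_eq => n /=; rewrite scalerA. Qed.

Fact bseqZ1 : left_id 1 bseqZ.
Proof. by move=> x; apply: bounded_seq_eq => n /=; rewrite scale1r. Qed.

Fact bseqZDr : right_distributive bseqZ +%R.
Proof. by move=> a x y; apply: bounded_seq_eq => n /=; rewrite scalerDr. Qed.

Fact bseqZDl x : {morph bseqZ^~ x : a b / a + b}.
Proof. by move=> a b; apply: bounded_seq_eq => n /=; rewrite scalerDl. Qed.

HB.instance Definition _ :=
  GRing.Zmodule_isLmodule.Build R bounded_seq bseqZA bseqZ1 bseqZDr bseqZDl.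

Definition ultra_form (x y : bounded_seq) : R :=
  ulim F (fun n => form (x n) (y n)).

Lemma ultra_formP (x y : bounded_seq) :
  (fun n => form (x n) (y n)) @ F --> ultra_form x y.
Proof.
have [c xc] := bseq_bounded x; have [b yb] := bseq_bounded y.
apply: (@ulimP _ _ _ _ (c * b)) => n; rewrite ler_norml lerNl -formNl.
have le u v : snorm u <= c -> snorm v <= b -> form u v <= c * b :> R.
  by move=> uc vb; rewrite (le_trans (form_le _ _)) ?ler_pM ?snorm_ge0.
by rewrite !le ?snormN.
Qed.

Fact ultra_formC x y : ultra_form x y = ultra_form y x.
Proof. by congr ulim; apply: funext => n; rewrite formC. Qed.

Fact ultra_formZD (a : R) (x y z : bounded_seq) :
  ultra_form (a *: x + y) z = a * ultra_form x z + ultra_form y z.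
Proof.
apply: ulim_unique; under eq_cvg do rewrite /= formP.
by apply: cvgD; [apply: cvgMr |]; exact: ultra_formP.
Qed.

Fact ultra_form_ge0 x : 0 <= ultra_form x x.
Proof.
apply: limr_ge; first exact: ultra_formP.
by apply: nearW => n; exact: form_ge0.
Qed.

Definition ultraproduct : preHilbert R :=
  @PreHilbert R (bounded_seq : lmodType R) ultra_form
    ultra_formC ultra_formZD ultra_form_ge0.

(** A strict inequality is an open condition, so if the ultralimit satisfies it, so do the terms
    along [F]. *)
Lemma ultraproduct_snorm_lt (x : ultraproduct) (e : R) : 0 < e ->
  snorm x < e -> \forall n \near F, snorm ((x : bounded_seq) n) < e.
Proof.
move=> e0 xe; have : ultra_form x x < e ^+ 2.
  rewrite -[ultra_form x x]/(form x x) -sqr_snorm ltr_sqr // nnegrE.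
    exact: snorm_ge0.
  exact: ltW.
move=> xe2; pose y : bounded_seq := x.
have near_xe : F [set n | form (y n) (y n) < e ^+ 2].
  exact: (@ultra_formP x x _ (lt_nbhsl xe2)).
apply: filterS near_xe => n /=; rewrite -sqr_snorm ltr_sqr // nnegrE.
  exact: snorm_ge0.
exact: ltW.
Qed.

Lemma ultraproduct_avg (u : nat -> ultraproduct) m n :
  (avg u m : bounded_seq) n = avg (fun k => (u k : bounded_seq) n) m.
Proof.
rewrite /avg -[LHS]/(_ *: _); congr (_ *: _).
by elim/big_rec2: _ => [|k y x _ <-].
Qed.

Lemma ultraproduct_avgB (u v : nat -> ultraproduct) m m' n :
  ((avg u m - avg v m' : ultraproduct) : bounded_seq) n =
  avg (fun k => (u k : bounded_seq) n) m -
  avg (fun k => (v k : bounded_seq) n) m'.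
Proof. by rewrite -!ultraproduct_avg. Qed.

Section UltraAction.
Variables (M : nmodType) (T : forall n, isometric_action M (X n)).

Fact ultra_act_bounded a (x : bounded_seq) :
  exists c, forall n, snorm (T n a (x n)) <= c.
Proof. by have [c xc] := bseq_bounded x; exists c => n; rewrite act_snorm. Qed.

Definition ultra_act a (x : ultraproduct) : ultraproduct :=
  BoundedSeq (ultra_act_bounded a x).

Fact ultra_act0 x : ultra_act 0 x = x.
Proof. by apply: bounded_seq_eq => n /=; rewrite act0. Qed.

Fact ultra_actD a b x : ultra_act (a + b) x = ultra_act a (ultra_act b x).
Proof. by apply: bounded_seq_eq => n /=; rewrite actD. Qed.

Fact ultra_actP a (c : R) x y :
  ultra_act a (c *: x + y) = c *: ultra_act a x + ultra_act a y.
Proof. by apply: bounded_seq_eq => n /=; rewrite actP. Qed.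

Fact ultra_act_form a x y : form (ultra_act a x) (ultra_act a y) = form x y.
Proof. by congr ulim; apply: funext => n /=; rewrite act_form. Qed.

Definition ultra_action : isometric_action M ultraproduct :=
  IsometricAction ultra_act0 ultra_actD ultra_actP ultra_act_form.

End UltraAction.

End Ultraproduct.

Arguments ultraproduct {R} F {FU} X.
Arguments ultra_action {R} F {FU X M} T.

(** * Uniform metastability by compactness *)

Lemma filter_all_seq (T : Type) (I : eqType) (F : set_system T) (s : seq I)
    (P : I -> T -> Prop) : Filter F ->
  (forall i, i \in s -> F (P i)) -> F [set t | forall i, i \in s -> P i t].
Proof.
move=> FF; elim: s => [|j s IHs] FP; first by apply: filterS filterT => t _ i.
apply: filterS2 (FP j (mem_head _ _)) (IHs _) => [t Pj Ps i|i si].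
  by rewrite inE => /predU1P[->//|]; exact: Ps.
by apply: FP; rewrite inE si orbT.
Qed.

(** Bundles a counterexample into one type, so that [choice] can select one for each [N]. *)
Record pointed_action (R : realType) (M : nmodType) := PointedAction {
  space : preHilbert R;
  action : isometric_action M space;
  point : space
}.

Theorem uniform_metastability (R : realType) (M : nmodType) d (p : nat -> M) L
    (c e : R) (eta : nat -> seq nat) : leadp d p L -> 0 < e ->
    (forall i j, j \in eta i -> (i <= j)%N) ->
  exists N, forall (X : preHilbert R) (T : isometric_action M X) (x : X),
    snorm x <= c -> exists2 i, (i <= N)%N &
      forall j k, j \in eta i -> k \in eta i ->
        snorm (avg (fun n => T (p n) x) j.+1 -
               avg (fun n => T (p n) x) k.+1) < e.
Proof.
move=> pL e0 eta_ge; apply: contrapT => /forallNP bad.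
have /choice[S badS] : forall N, exists S : pointed_action R M,
    snorm (point S) <= c /\ forall i, (i <= N)%N -> ~ (forall j k,
      j \in eta i -> k \in eta i ->
        snorm (avg (fun n => action S (p n) (point S)) j.+1 -
               avg (fun n => action S (p n) (point S)) k.+1) < e).
  move=> N; apply: contrapT => /forallNP good; apply: (bad N) => X T x xc.
  apply: contrapT => no; apply: (good (PointedAction T x)); split=> // i iN H.
  by apply: no; exists i.
have [F [FU ooF]] := ultraFilterLemma (eventually_filter).
pose X n := space (S n); pose T n := action (S n).
have xb : exists b, forall n, snorm (point (S n) : X n) <= b.
  by exists c => n; have [] := badS n.
pose x := (BoundedSeq xb : @ultraproduct R F FU X).
have e2 : 0 < e / 2 by lra.
(* The threshold [N0] of the ultraproduct serves as the index [i]; precision [e / 2] makes the later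
   inequality strict. *)
have [N0 osc] := polynomial_avg_cauchy (@ultra_action R F FU X M T) x pL e2.
pose P n j k := snorm (avg (fun i => T n (p i) (point (S n))) j.+1 -
               avg (fun i => T n (p i) (point (S n))) k.+1) < e.
have FP : F [set n | forall j, j \in eta N0 ->
    forall k, k \in eta N0 -> P n j k].
  apply: filter_all_seq => j jeta; apply: filter_all_seq => k keta.
  have lt_e : snorm (avg (fun n => ultra_action F T (p n) x) j.+1 -
      avg (fun n => ultra_action F T (p n) x) k.+1) < e.
    apply: le_lt_trans (osc _ _ _ _) _; rewrite ?leqW ?eta_ge //; lra.
  apply: filterS (ultraproduct_snorm_lt e0 lt_e) => n lt_en.
  by rewrite /P; move: lt_en; rewrite ultraproduct_avgB.
(* [F] refines the eventual filter, so some counterexample numbered at least [N0] is stable on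
   [eta N0]. *)
have FN : F [set n | (N0 <= n)%N] by apply: ooF; exact: nbhs_infty_ge.
have [n [Pn Nn]] := filter_ex (filterI FP FN).
by have [_ /(_ _ Nn)] := badS n; apply => j k jeta keta; exact: Pn.
Qed.

(** * Hilbert spaces as real spaces *)

Definition scalar_of {R : realType} {s} : R -> scalars R s :=
  match s with RealScalars => idfun | ComplexScalars => @real_complex R end.

(** An alias, so that the real scaling does not clash with the scaling of [H] by its own scalars. *)
Definition realified (R : realType) (s : scalar_kind)
  (H : hilbertSpace R s) : Type := H.

Section Realified.

Context {R : realType} {s : scalar_kind}.

Lemma scalar_ofM (a b : R) :
  scalar_of (a * b) = scalar_of a * scalar_of b :> scalars R s.
Proof. by case: s => //=; rewrite rmorphM. Qed.

Lemma scalar_ofD (a b : R) :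
  scalar_of (a + b) = scalar_of a + scalar_of b :> scalars R s.
Proof. by case: s => //=; rewrite rmorphD. Qed.

Lemma scalar_of1 : scalar_of 1 = 1 :> scalars R s.
Proof. by case: s. Qed.

Lemma scalar_of_natV n : scalar_of n%:R^-1 = n%:R^-1 :> scalars R s.
Proof. by case: s => //=; rewrite fmorphV rmorph_nat. Qed.

Lemma real_partD (a b : scalars R s) :
  real_part (a + b) = real_part a + real_part b.
Proof. by case: s a b => //= a b; rewrite raddfD. Qed.

Lemma real_part_scale a (z : scalars R s) :
  real_part (scalar_of a * z) = a * real_part z.
Proof. by case: s z => //= -[x y] /=; rewrite mul0r subr0. Qed.

Lemma real_part_conj (z : scalars R s) :
  real_part (conj_scalar z) = real_part z.
Proof. by case: s z => //= -[x y]. Qed.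

Lemma real_part_ge0 (z : scalars R s) : 0 <= z -> 0 <= real_part z.
Proof. by case: s z => //= -[x y]; rewrite lecE => /andP[]. Qed.

Lemma real_part_sqr (z : scalars R s) :
  0 <= z -> real_part (z ^+ 2) = real_part z ^+ 2.
Proof.
case: s z => //= -[x y]; rewrite lecE /= => /andP[/eqP-> _].
by rewrite !expr2 /= mul0r subr0.
Qed.

Lemma real_part_lt (z : scalars R s) (e : R) :
  0 <= z -> (z < scalar_of e) = (real_part z < e).
Proof.
case: s z => //= -[x y]; rewrite lecE ltcE /= => /andP[/eqP-> _].
by rewrite eqxx.
Qed.

Lemma real_part_le (z : scalars R s) (e : R) :
  0 <= z -> (z <= scalar_of e) = (real_part z <= e).
Proof.
case: s z => //= -[x y]; rewrite lecE lecE /= => /andP[/eqP-> _].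
by rewrite eqxx.
Qed.

Lemma real_part_gt0 (z : scalars R s) : 0 < z -> 0 < real_part z.
Proof. by case: s z => //= -[x y]; rewrite ltcE /= => /andP[]. Qed.

Lemma scalar_of_real (z : scalars R s) : 0 <= z -> z = scalar_of (real_part z).
Proof. by case: s z => //= -[x y]; rewrite lecE /= => /andP[/eqP-> _]. Qed.

Context (H : hilbertSpace R s).

HB.instance Definition _ :=
  GRing.Zmodule.copy (realified H) (hilbert_carrier H).

Definition real_scale (a : R) (x : realified H) : realified H :=
  (scalar_of a : scalars R s) *: (x : H).

Fact real_scaleA a b x : real_scale a (real_scale b x) = real_scale (a * b) x.
Proof. by rewrite /real_scale scalerA scalar_ofM. Qed.

Fact real_scale1 : left_id 1 real_scale.
Proof. by move=> x; rewrite /real_scale scalar_of1 scale1r. Qed.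

Fact real_scaleDr : right_distributive real_scale +%R.
Proof. by move=> a x y; rewrite /real_scale scalerDr. Qed.

Fact real_scaleDl x : {morph real_scale^~ x : a b / a + b}.
Proof. by move=> a b; rewrite /real_scale scalar_ofD scalerDl. Qed.

HB.instance Definition _ := GRing.Zmodule_isLmodule.Build R (realified H)
  real_scaleA real_scale1 real_scaleDr real_scaleDl.

Definition real_form (x y : realified H) : R := real_part (inner H x y).

Fact real_formC x y : real_form x y = real_form y x.
Proof.
rewrite /real_form (hermitian_subproof (s := inner H)) expr0 mul1r.
exact: real_part_conj.
Qed.

Fact real_formP a x y z :
  real_form (a *: x + y) z = a * real_form x z + real_form y z.
Proof.
have := linearPl (inner H) z (scalar_of a) x y => /= lin.
by rewrite /real_form [X in real_part X]lin real_partD real_part_scale.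
Qed.

Fact real_form_ge0 x : 0 <= real_form x x.
Proof. by rewrite /real_form -normr_inner real_part_ge0 ?exprn_ge0. Qed.

Definition realification :=
  @PreHilbert R (realified H : lmodType R) real_form
    real_formC real_formP real_form_ge0.

Lemma real_snorm (x : H) : snorm (x : realification) = real_part `|x|.
Proof.
rewrite /snorm /form /= /real_form -normr_inner real_part_sqr // sqrtr_sqr.
by rewrite ger0_norm // real_part_ge0.
Qed.

Lemma cesaro_avg (u : nat -> H) n :
  Defs.cesaro u n = avg (u : nat -> realification) n.+1.
Proof.
by rewrite /Defs.cesaro /avg /GRing.scale /= /real_scale scalar_of_natV.
Qed.

(** Here completeness of [H] enters. *)
Lemma osc_cvg (u : nat -> H) :
  (forall e, 0 < e -> osc_le (u : nat -> realification) e) ->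
  cvg (Defs.cesaro u @ \oo).
Proof.
move=> u_osc; apply/cauchy_cvgP/cauchy_exP => eps eps0.
(* The radius is a scalar of [H]; being positive, it is real. *)
have epsE := scalar_of_real (ltW eps0).
have e0 := real_part_gt0 eps0.
have [|N uN] := u_osc (real_part eps / 2); first by rewrite divr_gt0.
exists (Defs.cesaro u N), N => // n /= Nn.
rewrite -ball_normE /= [X in _ < X]epsE real_part_lt // -real_snorm !cesaro_avg.
have := uN N.+1 n.+1 (leqnSn _) (leqW Nn) => H1.
by apply: le_lt_trans H1 _; lra.
Qed.
End Realified.

(** * Exponents and actions of unitary operators *)

Section IntegerPolynomials.

(** Translation by 1 preserves the leading coefficient, which cancels in the difference. *)
Lemma size_difference_poly (q : {poly rat}) d : (size q <= d.+2)%N ->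
  (size (q \Po ('X + 1) - q)%R <= d.+1)%N.
Proof.
move=> qd; have sX : size ('X + 1 : {poly rat}) = 2%N.
  by rewrite -polyC1 size_XaddC.
have sq : size (q \Po ('X + 1)) = size q by rewrite size_comp_poly2.
apply/leq_sizeP => j; rewrite leq_eqVlt => /orP[/eqP<-|dj]; last first.
  by rewrite coefB !nth_default ?subrr ?sq ?(leq_trans qd).
move: qd; rewrite leq_eqVlt => /orP[/eqP qd|]; last first.
  by rewrite ltnS => qd; rewrite coefB !nth_default ?subrr ?sq.
have := @lead_coef_comp _ q ('X + 1).
rewrite sX => /(_ isT); rewrite -[in RHS]polyC1 lead_coefXaddC expr1n mulr1.
by rewrite !lead_coefE sq qd coefB /= => ->; rewrite subrr.
Qed.

Lemma int_polynomial_leadp d (p : int -> int) : int_polynomial_le d p ->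
  exists L, leadp d (fun k => p k%:Z) L.
Proof.
elim: d p => [|d IHd] p [q qd pq].
  exists (p 0) => k; apply: (@intr_inj rat); rewrite !pq.
  by rewrite (size1_polyC qd) !hornerC.
have [|L rL] := IHd (fun z => p (z + 1) - p z).
  exists (q \Po ('X + 1)  - q); first exact: size_difference_poly.
  by move=> z; rewrite rmorphB /= !pq !hornerE horner_comp !hornerE rmorphD.
exists L, (fun k => p (k%:Z + 1) - p k%:Z) => // k.
by rewrite addrC subrK -addn1 PoszD.
Qed.

Definition binomial_exponents d (k : nat) : {ffun 'I_d.+1 -> nat} :=
  [ffun i : 'I_d.+1 => 'C(k, i)].

Lemma binomial_exponents_leadp d : exists L, leadp d (binomial_exponents d) L.
Proof.
(* The [t]-th iterated difference of the exponents, by Pascal's rule. The factor [t <= i] is needed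
   because truncated subtraction would give 1 at [i < t]. [P d 0] is the indicator of the last
   coordinate. *)
pose P t k : {ffun 'I_d.+1 -> nat} :=
  [ffun i : 'I_d.+1 => ((t <= i) * 'C(k, i - t))%N].
suff H e t : (t + e)%N = d -> leadp e (P t) (P d 0%N).
  exists (P d 0%N); apply: leadp_ext (H d 0%N _) => // k.
  by apply/ffunP => i; rewrite !ffunE leq0n mul1n subn0.
elim: e t => [|e IHe] t => [|te].
  rewrite addn0 => -> k; apply/ffunP => i; rewrite !ffunE.
  have [di|//] := leqP d i.
  have /eqP-> : (i - d == 0)%N by rewrite subn_eq0 -ltnS.
  by rewrite !bin0.
exists (P t.+1); first by apply: IHe; rewrite addSnnS.
move=> k; apply/ffunP => i; rewrite !ffunE.
have [ti|it|<-] := ltngtP t i.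
- rewrite !mul1n subnS; have : (0 < i - t)%N by rewrite subn_gt0.
  by case: (i - t)%N => // j _; rewrite binS.
- by rewrite !mul0n.
- by rewrite subnn !bin0.
Qed.

End IntegerPolynomials.

(** * Unitary operators as isometric actions *)

Section UnitaryActions.

Context {R : realType} {s : scalar_kind} {H : hilbertSpace R s}.
Implicit Types U : unitary H.

Definition isometric (f : H -> H) :=
  (forall (a : scalars R s) x y, f (a *: x + y) = a *: f x + f y) /\
  (forall x y, inner H (f x) (f y) = inner H x y).

Lemma isometric_id : isometric idfun. Proof. by []. Qed.

Lemma isometric_comp f g : isometric f -> isometric g -> isometric (f \o g).
Proof.
move=> [fl fi] [gl gi]; split=> [a x y|x y] /=; first by rewrite gl fl.
by rewrite fi gi.
Qed.

Lemma isometric_iter f n : isometric f -> isometric (iter n f).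
Proof.
move=> fi; elim: n => [|n IHn]; first exact: isometric_id.
exact: isometric_comp.
Qed.

Lemma isometric_unitary U : isometric U.
Proof.
split=> [a x y|x y]; first by rewrite linearP.
by rewrite adjointP adjointK.
Qed.

(** Linearity is inherited from [U], of which the adjoint is the inverse. *)
Lemma isometric_adjoint U : isometric (adjoint U).
Proof.
split=> [a x y|x y]; last by rewrite -adjointP adjointVK.
by rewrite -[in LHS](adjointVK U x) -[in LHS](adjointVK U y) -linearP adjointK.
Qed.

(** Transparent, so that the action unfolds to [T]. *)
Definition realified_action (M : nmodType) (T : M -> H -> H)
  (T0 : forall v, T 0 v = v) (TD : forall a b v, T (a + b) v = T a (T b v))
  (Ti : forall a, isometric (T a)) : isometric_action M (realification H).
refine (@IsometricAction R M (realification H) T T0 TD _ _).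
- by move=> a c u v; exact: (Ti a).1.
- by move=> a u v; rewrite /form /= /real_form (Ti a).2.
Defined.

Lemma unitary_zpow_isometric U m : isometric (unitary_zpow U m).
Proof.
by case: m => n; apply: isometric_iter;
  [exact: isometric_unitary | exact: isometric_adjoint].
Qed.

Lemma unitary_zpowS U m v : unitary_zpow U (m + 1) v = unitary_zpow U m (U v).
Proof.
case: m => n; first by rewrite -PoszD addn1 -[LHS]/(iter n.+1 U v) iterSr.
case: n => [|n]; first by rewrite /= adjointK.
have -> : Negz n.+1 + 1 = Negz n.
  by rewrite !NegzE -[n.+2]addn1 PoszD opprD subrK.
by rewrite -[RHS]/(iter n.+2 (adjoint U) (U v)) iterSr adjointK.
Qed.

Lemma unitary_zpowD U a b v :
  unitary_zpow U (a + b) v = unitary_zpow U a (unitary_zpow U b v).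
Proof.
elim/int_rect: b v => [|n IHn|n IHn] v; first by rewrite addr0.
- by rewrite -addn1 PoszD addrA !unitary_zpowS IHn.
(* Writing [v] as [U (adjoint U v)] raises both exponents by one, back to the induction
   hypothesis. *)
- rewrite -[v](adjointVK U) -unitary_zpowS -(unitary_zpowS U (- _)).
  by rewrite -addn1 PoszD opprD -addrA subrK IHn.
Qed.

Definition zpow_action U : isometric_action int (realification H) :=
  realified_action (fun=> erefl) (unitary_zpowD U) (unitary_zpow_isometric U).

Section CommutingWords.
Variables (d : nat) (U : 'I_d.+1 -> unitary H).

Definition word (a : {ffun 'I_d.+1 -> nat}) : H -> H :=
  \big[(fun f g : H -> H => f \o g)/idfun]_(i < d.+1) iter (a i) (U i).

Lemma binomial_wordE k : binomial_word U k = word (binomial_exponents d k).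
Proof. by apply: eq_bigr => i _; rewrite ffunE. Qed.

Lemma word_isometric a : isometric (word a).
Proof.
apply: (big_ind isometric); first exact: isometric_id.
  by move=> f g; exact: isometric_comp.
by move=> i _; apply/isometric_iter/isometric_unitary.
Qed.

Lemma word0 v : word 0 v = v.
Proof.
apply: (big_ind (fun f : H -> H => f v = v)) => // [f g fv gv|i _] /=.
  by rewrite gv.
by rewrite ffunE.
Qed.

Hypothesis commU : pairwise_commuting U.

Lemma iter_unitary_comm i j m n v :
  iter m (U i) (iter n (U j) v) = iter n (U j) (iter m (U i) v).
Proof.
have swap k w : U i (iter k (U j) w) = iter k (U j) (U i w).
  by elim: k => //= k IHk; rewrite -IHk; exact: commU.
by elim: m => //= m ->; exact: swap.
Qed.

Lemma wordD a b v : word (a + b) v = word a (word b v).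
Proof.
rewrite /word; elim: (index_enum _) => [|i r IHr]; first by rewrite !big_nil.
rewrite !big_cons /= ffunE iterD IHr; congr (iter _ _ _).
(* It remains to move the iterate of [U i] past the other factors of [word a]. *)
move: (\big[_/_]_(j <- r) iter (b j) (U j)) => w.
elim: r {IHr} => [|j r IHr]; first by rewrite !big_nil.
by rewrite !big_cons /= -IHr iter_unitary_comm.
Qed.

Definition word_action :
    isometric_action {ffun 'I_d.+1 -> nat} (realification H) :=
  realified_action word0 wordD word_isometric.

End CommutingWords.

End UnitaryActions.

(** * Convergence theorems and the universal rate *)

Lemma initial_segment_neq0 N : [fset i in iota 0 N.+1]%fset != fset0.
Proof. by apply/fset0Pn; exists 0%N; rewrite in_fset mem_iota. Qed.

Definition initial_segment N : finite_nonempty_ge 0 :=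
  FiniteNonemptyGe (initial_segment_neq0 N) (fun j _ => leq0n j).

Lemma cvg_binomial_average (R : realType) (s : scalar_kind)
    (H : hilbertSpace R s) d (U : 'I_d.+1 -> unitary H) (x : H) :
  pairwise_commuting U -> cvg (binomial_average U x @ \oo).
Proof.
move=> commU; apply: osc_cvg => e e0.
have [L pL] := binomial_exponents_leadp d.
rewrite (_ : (fun k => _) =
  fun k => word_action commU (binomial_exponents d k) x).
  exact: polynomial_avg_cauchy pL e0.
by apply: funext => k; rewrite binomial_wordE.
Qed.

Lemma cvg_power_average (R : realType) (s : scalar_kind)
    (H : hilbertSpace R s) d (U : unitary H) (p : int -> int) (x : H) :
  int_polynomial_le d p -> cvg (power_average p U x @ \oo).
Proof.
move=> /int_polynomial_leadp[L pL]; apply: osc_cvg => e e0.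
exact: (polynomial_avg_cauchy (zpow_action U) x pL e0).
Qed.

Lemma universal_metastability_rate (R : realType) d :
  exists E : metastability_rate R,
    forall (s : scalar_kind) (H : hilbertSpace R s)
      (U : 'I_d.+1 -> unitary H),
    pairwise_commuting U ->
    forall x : H, `|x| <= 1 ->
    rate_applies hilbert_dist E (binomial_average U x).
Proof.
have [L pL] := binomial_exponents_leadp d.
(* [cid] selects a bound for each precision and sampling before any Hilbert space is given. *)
have bound (eps : R) (eps0 : 0 < eps) (eta : sampling) :=
  cid (uniform_metastability 1 (eta := eta) pL eps0
    (fun i j => @fin_set_ge i (eta i) j)).
exists (fun eps eps0 eta => initial_segment (sval (bound eps eps0 eta))).
move=> s H U commU x x1 eps eps0 eta.
have xs : snorm (x : realification H) <= 1.
  by rewrite real_snorm -real_part_le // scalar_of1.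
have [i iN close] := svalP (bound eps eps0 eta) _ (word_action commU) x xs.
exists i; first by rewrite in_fset mem_iota ltnS.
(* Being below [eps] holds for the base value 0 and passes to maxima, so single distances
   suffice. *)
rewrite big_seq; elim/big_ind: _ => // [a b ae be|j jeta].
  by rewrite gt_max ae.
rewrite big_seq; elim/big_ind: _ => // [a b ae be|k keta].
  by rewrite gt_max ae.
rewrite /hilbert_dist -real_snorm /binomial_average !cesaro_avg.
rewrite (_ : (fun k => _) =
  fun k => word_action commU (binomial_exponents d k) x).
  exact: close.
by apply: funext => n; rewrite binomial_wordE.
Qed.

Theorem theorem1 (R : realType) (d : nat) :
  [/\ (forall (s : scalar_kind) (H : hilbertSpace R s)
         (U : 'I_d.+1 -> unitary H),
         pairwise_commuting U ->
         forall x : H, cvg (binomial_average U x @ \oo)),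
      (forall (s : scalar_kind) (H : hilbertSpace R s) (U : unitary H)
         (p : int -> int),
         int_polynomial_le d p ->
         forall x : H, cvg (power_average p U x @ \oo)) &
      (exists E : metastability_rate R,
         forall (s : scalar_kind) (H : hilbertSpace R s)
           (U : 'I_d.+1 -> unitary H),
           pairwise_commuting U ->
           forall x : H, `|x| <= 1 ->
           rate_applies hilbert_dist E (binomial_average U x))].
Proof.
split; last exact: universal_metastability_rate.
- by move=> s H U commU x; exact: cvg_binomial_average.
- by move=> s H U p pd x; exact: cvg_power_average pd.
Qed.
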